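(* Let $N$ be even and let $g=g_{1,N}\in\mathbb{G}[x_1,\ldots,x_N]$ be the Raz–Yehudayoff polynomial described in the context. Let $\alpha>1/10$ and let $f_1,\ldots,f_m$ be polynomials computed by $\alpha$-sparse ROABPs of size $s<2^{N^{9/40}/\log N}$ such that $g=f_1+\cdots+f_m$. Then $m\ge 2^{N^{1/11}}$.
   Context: Let $\mathbb{F}$ be a field, $X=\{x_1,\ldots,x_N\}$ with $N$ even, $\mathcal{W}=\{w_{i,k,j}\}_{i,k,j\in[N]}$ further variables and $\mathbb{G}=\mathbb{F}(\mathcal{W})$. For an interval $[i,j]$ of even length define $g_{i,j}\in\mathbb{G}[X]$ by $g_{i,j}=1$ if $|[i,j]|=0$, and otherwise $g_{i,j}=(1+x_ix_j)g_{i+1,j-1}+\sum_k w_{i,k,j}g_{i,k}g_{k+1,j}$, the sum over $k\in[i+1,j-2]$ with $|[i,k]|$ even; $g=g_{1,N}$. An ABP is a layered DAG with start node $s$ and terminal node $t$ whose edges carry labels (here polynomials), computing the sum over $s$-$t$ paths of the product of labels; size = number of nodes. An $\alpha$-sparse ROABP is an ABP with $d+1$ layers $L_0,\ldots,L_d$ for which there is a partition of $X$ into $d=\Theta(N^\alpha)$ sets $X_1,\ldots,X_d$ with $|X_i|=N/d$ such that every edge label leaving layer $L_i$ is a $t$-sparse multilinear polynomial in $\mathbb{F}[X_i]$ (at most $t$ monomials with nonzero coefficient), with $t=N^{O(1)}$.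
   Formalization: The bound is proved for all sufficiently large even N, with the threshold depending on α and the constants in d=Θ(N^α) and t=N^{O(1)}; for N=2 it fails, since g=1+x_1x_2 is a single program of size 2. Edge labels may have coefficients in G, and log is base 2. *)

(* Defs.v *)
From HB Require Import structures.
From mathcomp Require Import all_boot all_order all_algebra.
From mathcomp Require Import reals exp.
From mathcomp Require Import mpoly.
From mathcomp Require Import zify.

Set Implicit Arguments.
Unset Strict Implicit.
Unset Printing Implicit Defensive.

Import GRing.Theory.

Local Open Scope ring_scope.

Section RazYehudayoff.

Variables (F : fieldType) (N : nat).

Definition Windex : finType := ('I_N * 'I_N * 'I_N)%type.

(* The field of rational functions F(W), one variable per triple (i, k, j). *)
Definition ratW : fieldType := {fraction {mpoly F[#|Windex|]}}.

(* Indices are the 1-based naturals 1, ..., N; the variable of index i is the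
   one numbered i - 1 in 'I_N. The value 0 at out-of-range indices is junk and
   is never reached from the interval [1, N]. *)
Definition ord_of_index (i : nat) : option 'I_N :=
  if i is i'.+1 then insub i' else None.

Definition xvar (i : nat) : {mpoly ratW[N]} :=
  if ord_of_index i is Some o then 'X_o else 0.

Definition wvar (i k j : nat) : ratW :=
  if (ord_of_index i, ord_of_index k, ord_of_index j)
    is (Some a, Some b, Some c)
  then tofrac ('X_(enum_rank ((a, b, c) : Windex)) : {mpoly F[#|Windex|]})
  else 0.

Definition itv_len (i j : nat) : nat := (j.+1 - i)%N.

(* Recursion on a bound [n] for the length of the interval [i, j]. *)
Fixpoint ry_rec (n i j : nat) : {mpoly ratW[N]} :=
  if n is n'.+1 then
    if itv_len i j == 0%N then 1
    else (1 + xvar i * xvar j) * ry_rec n' i.+1 j.-1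
         + \sum_(i.+1 <= k < j.-1 | ~~ odd (itv_len i k))
             wvar i k j *: (ry_rec n' i k * ry_rec n' k.+1 j)
  else 1.

Definition ry_itv (i j : nat) : {mpoly ratW[N]} := ry_rec (itv_len i j) i j.

Definition ry_poly : {mpoly ratW[N]} := ry_itv 1 N.

Lemma ry_rec_bound n1 n2 i j :
  (itv_len i j <= n1)%N -> (itv_len i j <= n2)%N ->
  ry_rec n1 i j = ry_rec n2 i j.
Proof.
rewrite /itv_len; elim: n1 n2 i j => [|n1 IH] [|n2] i j //= le1 le2.
- by rewrite ifT // /itv_len; lia.
- by rewrite ifT // /itv_len; lia.
- case: ifP => [//|/negbT nz]; rewrite /itv_len in nz.
  congr (_ * _ + _); first by apply: IH; lia.
  rewrite big_nat_cond [RHS]big_nat_cond; apply: eq_bigr => k /andP[hk _].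
  by congr (_ *: (_ * _)); apply: IH; lia.
Qed.

(* The defining recurrence, for nonempty [i, j]; the index [k]
   ranges over [i + 1, j - 2]. *)
Lemma ry_itvE i j : (i <= j)%N ->
  ry_itv i j =
    (1 + xvar i * xvar j) * ry_itv i.+1 j.-1
    + \sum_(i.+1 <= k < j.-1 | ~~ odd (itv_len i k))
        wvar i k j *: (ry_itv i k * ry_itv k.+1 j).
Proof.
move=> le_ij; rewrite {1}/ry_itv.
have -> : itv_len i j = (j - i).+1 by rewrite /itv_len; lia.
rewrite [LHS]/= ifF; last by rewrite /itv_len; lia.
congr (_ * _ + _); first by apply: ry_rec_bound; rewrite /itv_len; lia.
rewrite big_nat_cond [RHS]big_nat_cond; apply: eq_bigr => k /andP[hk _].
by congr (_ *: (_ * _)); apply: ry_rec_bound; rewrite /itv_len; lia.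
Qed.

Lemma ry_itv0 i j : itv_len i j = 0%N -> ry_itv i j = 1.
Proof. by rewrite /ry_itv => ->. Qed.

End RazYehudayoff.

(* A layered digraph with layers 0, ..., d; edges go from one layer to the
   next. The value of [abp_label] off the edges is irrelevant. *)
Record abp (A : Type) (d : nat) := Abp {
  abp_node : finType;
  abp_layer : abp_node -> 'I_d.+1;
  abp_edge : rel abp_node;
  abp_label : abp_node -> abp_node -> A;
  abp_src : abp_node;
  abp_snk : abp_node;
  abp_src_layer : abp_layer abp_src = 0%N :> nat;
  abp_snk_layer : abp_layer abp_snk = d :> nat;
  abp_edge_layer : forall u v, abp_edge u v ->
    abp_layer v = (abp_layer u).+1 :> nat
}.

Definition abp_size (A : Type) (d : nat) (P : abp A d) : nat :=
  #|abp_node P|.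

(* The layers force every source-to-sink path to have exactly [d] edges, so
   summing over [d]-tuples of successors of the source loses no path. *)
Definition abp_eval (A : pzSemiRingType) (d : nat) (P : abp A d) : A :=
  \sum_(p : d.-tuple (abp_node P) |
           path (@abp_edge _ _ P) (abp_src P) p
           && (last (abp_src P) p == abp_snk P))
     \prod_(a <- pairmap (@abp_label _ _ P) (abp_src P) p) a.

Section SparseROABP.

Variables (K : fieldType) (N : nat).

Definition multilinear (p : {mpoly K[N]}) : Prop :=
  forall m, m \in msupp p -> forall i, (m i <= 1)%N.

Definition sparse (t : nat) (p : {mpoly K[N]}) : Prop :=
  (size (msupp p) <= t)%N.

Definition in_vars (X : {set 'I_N}) (p : {mpoly K[N]}) : Prop :=
  forall m, m \in msupp p -> forall i, m i != 0%N -> i \in X.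

Definition equipartition (d : nat) (X : 'I_d -> {set 'I_N}) : Prop :=
  [/\ forall i j, i != j -> [disjoint X i & X j],
      \bigcup_i X i = [set: 'I_N]
    & forall i, (#|X i| * d = N)%N].

(* With 0-based blocks, the edges leaving layer [i] read the block [X i]. *)
Definition sparse_roabp (t d : nat) (P : abp {mpoly K[N]} d) : Prop :=
  exists X : 'I_d -> {set 'I_N}, equipartition X /\
    forall (i : 'I_d) (u v : abp_node P),
      abp_edge u v -> abp_layer u = i :> nat ->
      [/\ in_vars (X i) (abp_label u v), multilinear (abp_label u v)
        & sparse t (abp_label u v)].

(* [c1] and [c2] are the constants of d = Theta(N^alpha), and [C] is the
   exponent of t = N^O(1). *)
Definition alpha_sparse_roabp (R : realType) (alpha c1 c2 : R) (C d : nat)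
    (P : abp {mpoly K[N]} d) : Prop :=
  [/\ (c1 * N%:R `^ alpha <= d%:R)%R,
      (d%:R <= c2 * N%:R `^ alpha)%R
    & exists2 t : nat, (t <= N ^ C)%N & sparse_roabp t P].

End SparseROABP.

Definition log2 (R : realType) (x : R) : R := ln x / ln 2.

(* Main.v *)
(* A program reading the blocks in some order can be cut at any layer, which
   writes its polynomial as a sum of at most s products p_u * q_u, with p_u in the
   variables P read before the cut and q_u in the others. For a set S of half of
   the variables, the coefficient matrix of such a sum, with rows indexed by the
   monomials in S and columns by the monomials outside S, has rank at most
   s * 2^(N/2 - b), where b is the imbalance between S and its complement on P.
   For a random S, the random walk of imbalances over about N^(1/10) equally
   spaced cuts stays small only if every chunk between consecutive cuts is nearly
   even, which has probability at most 1/2 for each chunk. As a balanced S is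
   only polynomially rare, a union bound over fewer than 2^(N^(1/11)) programs
   gives a balanced S for which every program has small rank.

   On the other hand the matrix of g is nonsingular for every balanced S:
   specialising the weights to suitable powers of one indeterminate makes the
   product of 1 + x_i x_p(i), over the pairs of a noncrossing matching p of S with
   its complement, the leading term of g. *)

Require Import Defs.
From mathcomp Require Import all_boot all_order all_algebra.
From mathcomp Require Import reals exp.
From mathcomp Require Import mpoly.
From mathcomp Require Import perm zify lra.

Set Implicit Arguments.
Unset Strict Implicit.
Unset Printing Implicit Defensive.

Import Order.TTheory GRing.Theory Num.Theory.

(** * Binomial coefficients *)

Lemma leq_bin_half n j : 'C(n, j) <= 'C(n, n./2).
Proof.
have mono i : i.+1 <= n./2 -> 'C(n, i) <= 'C(n, i.+1).
  move=> lt_i; rewrite -(leq_pmul2l (ltn0Sn i)) mul_bin_left leq_mul2r.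
  by apply/orP; right; lia.
have lower_half i : i <= n./2 -> 'C(n, i) <= 'C(n, n./2).
  move=> le_i; rewrite -(subKn le_i).
  elim: (n./2 - i) (leq_subr i n./2) => [|e IH] le_e; first by rewrite subn0.
  apply: leq_trans (IH (ltnW le_e)).
  have -> : n./2 - e = (n./2 - e.+1).+1 by lia.
  by apply: mono; lia.
case: (leqP j n./2) => [/lower_half//|gt_j].
case: (leqP j n) => [le_jn|lt_nj]; last by rewrite bin_small.
by rewrite -(bin_sub le_jn); apply: lower_half; lia.
Qed.

Lemma mul_central_binS p :
  p.+1 * 'C(p.+1.*2, p.+1) = 2 * p.*2.+1 * 'C(p.*2, p).
Proof.
have := mul_bin_diag p.*2.+2 p; have := mul_bin_down p.*2.+1 p.
by rewrite /= doubleS (_ : p.*2.+1 - p = p.+1); [nia|lia].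
Qed.

Lemma central_bin_sqr_leq p : 'C(p.*2, p) ^ 2 * p.*2.+1 <= 16 ^ p.
Proof.
elim: p => [//|p IH].
rewrite -(leq_pmul2l (_ : 0 < p.+1 ^ 2)) ?expn_gt0 //.
rewrite mulnA -expnMn mul_central_binS expnMn (expnS 16) doubleS.
move: ('C(_, _) ^ 2) (16 ^ p) IH => c e IH.
have -> : (2 * p.*2.+1) ^ 2 * c * p.*2.+3
   = (4 * p.*2.+1 * p.*2.+3) * (c * p.*2.+1) by rewrite -!mulnn; lia.
apply: (@leq_trans ((4 * p.*2.+1 * p.*2.+3) * e)).
  by rewrite leq_mul2l IH orbT.
by rewrite mulnA leq_mul2r -!mulnn; apply/orP; right; lia.
Qed.

Lemma bin_sqr_leq n j : 'C(n, j) ^ 2 * n <= 4 ^ n.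
Proof.
apply: (@leq_trans ('C(n, n./2) ^ 2 * n)).
  by rewrite leq_mul2r leq_sqr leq_bin_half orbT.
have exp4_double p : 4 ^ p.*2 = 16 ^ p by rewrite -mul2n expnM.
have := odd_double_half n; set p := n./2; clearbody p => <-.
case: (odd n); last first.
  rewrite add0n exp4_double; apply: leq_trans (central_bin_sqr_leq _).
  by rewrite leq_mul2l leqnSn orbT.
have le2 : 'C(1 + p.*2, p) <= 2 * 'C(p.*2, p).
  rewrite add1n; case: p => [|p]; first by rewrite !bin0.
  rewrite binS mulSn mul1n leq_add2l.
  by have := leq_bin_half p.+1.*2 p; rewrite doubleK.
apply: (@leq_trans ((2 * 'C(p.*2, p)) ^ 2 * (1 + p.*2))).
  by rewrite leq_mul2r leq_sqr le2 orbT.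
by rewrite expnMn expnD exp4_double -mulnA leq_mul2l /= central_bin_sqr_leq.
Qed.

Lemma exp2_leq_central_bin n : 2 ^ n <= n.+1 * 'C(n, n./2).
Proof.
rewrite -[2]/(1 + 1) expnDn.
apply: (@leq_trans (\sum_(i < n.+1) 'C(n, n./2))).
  by apply: leq_sum => i _; rewrite !exp1n !muln1 leq_bin_half.
by rewrite sum_nat_const card_ord.
Qed.

(** * Counting nearly balanced sets *)

Lemma leq_card_bigcup (I T : finType) (D : I -> {set T}) :
  #|\bigcup_i D i| <= \sum_i #|D i|.
Proof.
elim/big_rec2: _ => [|i n A _ le_n]; first by rewrite cards0.
by apply: leq_trans (leq_card_setU _ _) _; rewrite leq_add2l.
Qed.

Section Counting.
Variable T : finType.
Implicit Types (C S : {set T}).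

Lemma card_split_predI C (Q A : pred {set T}) : (forall S, Q S = Q (S :\: C)) ->
  #|[set S : {set T} | Q S && A (S :&: C)]| =
  #|[set S in powerset (~: C) | Q S]| * #|[set S in powerset C | A S]|.
Proof.
move=> Q_setD; rewrite -cardsX.
have inj_split : injective (fun S => (S :\: C, S :&: C)).
  by move=> S1 S2 [eqD eqI]; rewrite -(setID S1 C) eqD eqI setID.
rewrite -(card_imset _ inj_split); apply: eq_card => -[S1 S2]; rewrite !inE /=.
apply/imsetP/andP => [[S] |[/andP[sS1 QS1] /andP[sS2 AS2]]].
  rewrite inE => /andP[QS AS] [-> ->].
  by rewrite setDE subsetIr subsetIr -setDE -Q_setD QS AS.
have S1C : S1 :\: C = S1 by apply/setDidPl; rewrite disjoints_subset.
have S1I : S1 :&: C = set0 by apply/disjoint_setI0; rewrite disjoints_subset.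
have S2D : S2 :\: C = set0 by apply/eqP; rewrite setD_eq0.
have traceD : (S1 :|: S2) :\: C = S1 by rewrite setDUl S1C S2D setU0.
have traceI : (S1 :|: S2) :&: C = S2 by rewrite setIUl S1I set0U (setIidPl sS2).
by exists (S1 :|: S2); rewrite ?inE ?traceD ?traceI // Q_setD traceD QS1.
Qed.

Lemma card_split_predI_half C (Q A : pred {set T}) :
    (forall S, Q S = Q (S :\: C)) ->
    #|[set S in powerset C | A S]| * 2 <= 2 ^ #|C| ->
  #|[set S : {set T} | Q S && A (S :&: C)]| * 2 <= #|[set S : {set T} | Q S]|.
Proof.
move=> Q_setD half_A.
have -> : [set S : {set T} | Q S] = [set S | Q S && predT (S :&: C)].
  by apply/setP => S; rewrite !inE andbT.
rewrite !card_split_predI // -mulnA leq_mul2l; apply/orP; right.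
apply: leq_trans half_A _; rewrite -card_powerset.
by apply/subset_leq_card/subsetP => S; rewrite !inE andbT.
Qed.

Definition imbalance S (P : {set T}) : nat := `|(2 * #|S :&: P|)%N - #|P|%N|.

Lemma imbalance_eqI (P S S' : {set T}) :
  S :&: P = S' :&: P -> imbalance S P = imbalance S' P.
Proof. by rewrite /imbalance => ->. Qed.

Lemma imbalance_setD S (P P' : {set T}) : P \subset P' ->
  imbalance S (P' :\: P) <= imbalance S P + imbalance S P'.
Proof.
move=> sPP'; have cP' := cardsID P P'; have cS := cardsID P (S :&: P').
rewrite -setIA (setIidPr sPP') in cS; rewrite (setIidPr sPP') in cP'.
by rewrite /imbalance setIDA; lia.
Qed.

(* Each of the at most [c] possible cardinals of [S] is that of a proportion
   at most [1 / sqrt #|C| <= 1 / (2 * c)] of the subsets of [C]. *)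
Lemma card_small_imbalance_half c C : 4 * c ^ 2 <= #|C| ->
  #|[set S in powerset C | imbalance S C < c]| * 2 <= 2 ^ #|C|.
Proof.
set n := #|C|; set X := [set S in _ | _] => le_c.
have [c0|c_gt0] := posnP c.
  by rewrite (_ : X = set0) ?cards0 //; apply/setP => S; rewrite !inE c0 andbF.
have le_cn : c <= n by move: le_c; rewrite -mulnn; nia.
pose lo := ((n - c)./2).+1.
pose D (i : 'I_c) := [set S : {set T} | S \subset C & #|S| == lo + i].
have card_D i : 2 * c * #|D i| <= 2 ^ n.
  rewrite /D cards_draws -leq_sqr -[leqRHS]expnM (mulnC n) (expnM 2 2).
  apply: leq_trans _ (bin_sqr_leq n (lo + i)).
  by rewrite expnMn mulnC leq_mul2l expnMn le_c orbT.
have sum_D : #|X| <= \sum_i #|D i|.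
  apply: leq_trans _ (leq_card_bigcup D).
  apply/subset_leq_card/subsetP => S; rewrite !inE => /andP[sSC].
  rewrite /imbalance (setIidPl sSC) -/n => small.
  have := subset_leq_card sSC; rewrite -/n => le_Sn.
  have lt_c : #|S| - lo < c by rewrite /lo; lia.
  apply/bigcupP; exists (Ordinal lt_c) => //.
  by rewrite inE sSC /= subnKC // /lo; lia.
rewrite -(leq_pmul2l c_gt0) (mulnC _ 2) mulnA (mulnC c 2).
apply: (@leq_trans (2 * c * \sum_i #|D i|)); first by rewrite leq_mul2l sum_D orbT.
rewrite big_distrr /=; apply: (@leq_trans (\sum_(i < c) 2 ^ n)).
  exact: leq_sum.
by rewrite sum_nat_const card_ord.
Qed.

Definition near_even_sets (P : nat -> {set T}) b r : {set {set T}} :=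
  [set S | [forall a : 'I_r.+1, imbalance S (P a) < b]].

Lemma near_even_setsP (P : nat -> {set T}) b r S :
  reflect (forall a, a <= r -> imbalance S (P a) < b) (S \in near_even_sets P b r).
Proof.
rewrite inE; apply: (iffP forallP) => [near a le_a|near a].
  exact: near (Ordinal (le_a : a < r.+1)).
by apply: near; rewrite -ltnS.
Qed.

(* Given the trace of [S] on [P r], at most half of the choices of the trace on
   the next chunk keep the imbalance small. *)
Lemma card_near_even_sets (P : nat -> {set T}) b r :
    {homo P : a a' / a <= a' >-> a \subset a'} ->
    (forall a, a < r -> 16 * b ^ 2 <= #|P a.+1 :\: P a|) ->
  #|near_even_sets P b r| * 2 ^ r <= 2 ^ #|T|.
Proof.
move=> homoP; elim: r => [|r IH] big_chunk.
  by rewrite muln1 -cardsT -card_powerset powersetT; apply/subset_leq_card/subsetT.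
set C := P r.+1 :\: P r.
have near_setD S : (S \in near_even_sets P b r) = (S :\: C \in near_even_sets P b r).
  rewrite !inE; apply: eq_forallb => a.
  rewrite (@imbalance_eqI _ (S :\: C) S) //; apply/setP => x; rewrite !inE.
  have [xP|] := boolP (x \in P a); last by rewrite !andbF.
  by rewrite (subsetP (homoP _ _ (ltn_ord a : a <= r)) _ xP).
have small_chunk : #|[set S in powerset C | imbalance S C < b.*2]| * 2 <= 2 ^ #|C|.
  apply: card_small_imbalance_half; apply: leq_trans (big_chunk _ (ltnSn r)).
  by rewrite -mul2n expnMn mulnA.
apply: leq_trans (IH _) => [|a lt_a]; last by apply: big_chunk; exact: ltnW.
rewrite expnS mulnA leq_mul2r; apply/orP; right.
have half := card_split_predI_half near_setD small_chunk.
have -> : #|near_even_sets P b r| = #|[set S | S \in near_even_sets P b r]|.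
  by apply: eq_card => S; rewrite [RHS]inE.
apply: leq_trans half.
rewrite leq_mul2r; apply/subset_leq_card/subsetP => S /near_even_setsP near.
rewrite inE; apply/andP; split.
  by apply/near_even_setsP => a le_a; apply: near; exact: leqW.
rewrite (@imbalance_eqI _ _ S) -?setIA ?setIid //.
apply: leq_ltn_trans (imbalance_setD S (homoP _ _ (leqnSn r))) _.
by have := near r (leqnSn r); have := near r.+1 (leqnn _); lia.
Qed.

Lemma exists_half_set_avoiding (I : finType) (bad : I -> {set {set T}}) :
  (\sum_i #|bad i|) * #|T|.+1 < 2 ^ #|T| ->
  exists2 S : {set T}, #|S| = #|T|./2 & forall i, S \notin bad i.
Proof.
move=> few_bad; pose half_sets := [set S : {set T} | #|S| == #|T|./2].
have : ~~ (half_sets \subset \bigcup_i bad i).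
  apply/negP => /subset_leq_card /leq_trans/(_ (leq_card_bigcup bad)) le_bad.
  move: few_bad; rewrite ltnNge => /negP[].
  apply: leq_trans (exp2_leq_central_bin _) _.
  by rewrite mulnC leq_mul2r -card_draws le_bad orbT.
case/subsetPn => S; rewrite inE => /eqP card_S /bigcupP not_bad.
by exists S => // i; apply/negP => bad_S; apply: not_bad; exists i.
Qed.

End Counting.

Local Open Scope ring_scope.

(** * Polynomials in disjoint sets of variables *)

Section DisjointVariables.
Variables (K : fieldType) (n : nat).
Implicit Types (p q : {mpoly K[n]}) (P Q V W : {set 'I_n}).

Definition set_mnm V : 'X_{1..n} := [multinom (i \in V : nat) | i < n].

Lemma set_mnm_inj : injective set_mnm.
Proof.
move=> V W /mnmP eqVW; apply/setP => i; have := eqVW i; rewrite !mnmE.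
by case: (i \in V); case: (i \in W).
Qed.

Lemma set_mnm0 : set_mnm set0 = 0%MM.
Proof. by apply/mnmP => i; rewrite mnm0E mnmE inE. Qed.

Lemma set_mnm1 i : set_mnm [set i] = U_(i)%MM.
Proof. by apply/mnmP => j; rewrite mnm1E mnmE inE eq_sym. Qed.

Lemma set_mnmU V W : [disjoint V & W] ->
  set_mnm (V :|: W) = (set_mnm V + set_mnm W)%MM.
Proof.
move=> disVW; apply/mnmP => i; rewrite mnmDE !mnmE inE.
by have [iV|//] := boolP (i \in V); rewrite (disjointFr disVW iV).
Qed.

Lemma in_varsS P Q p : P \subset Q -> in_vars P p -> in_vars Q p.
Proof. by move=> /subsetP sPQ pP m /pP mP i /mP/sPQ. Qed.

Lemma in_vars0 P : in_vars P (0 : {mpoly K[n]}).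
Proof. by move=> m; rewrite msupp0. Qed.

Lemma in_vars1 P : in_vars P (1 : {mpoly K[n]}).
Proof. by move=> m; rewrite msupp1 inE => /eqP-> i; rewrite mnm0E. Qed.

Lemma in_varsX P i : i \in P -> in_vars P ('X_i : {mpoly K[n]}).
Proof.
move=> iP m; rewrite msuppX inE => /eqP-> j; rewrite mnm1E eqb0 negbK.
by move/eqP <-.
Qed.

Lemma in_varsD P p q : in_vars P p -> in_vars P q -> in_vars P (p + q).
Proof. by move=> pP qP m /msuppD_le; rewrite mem_cat => /orP[/pP|/qP]. Qed.

Lemma in_varsZ P c p : in_vars P p -> in_vars P (c *: p).
Proof. by move=> pP m /msuppZ_le/pP. Qed.

Lemma in_varsM P p q : in_vars P p -> in_vars P q -> in_vars P (p * q).
Proof.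
move=> pP qP m /msuppM_le/allpairsP[[m1 m2] /= [/pP m1P /qP m2P ->]] i.
by rewrite mnmDE addn_eq0 negb_and => /orP[/m1P|/m2P].
Qed.

Lemma in_vars_sum P (I : Type) (r : seq I) (A : pred I) (f : I -> {mpoly K[n]}) :
  (forall i, A i -> in_vars P (f i)) -> in_vars P (\sum_(i <- r | A i) f i).
Proof.
move=> fP; apply: (big_ind (in_vars P)) => //; first exact: in_vars0.
exact: in_varsD.
Qed.

Definition mnm_in_vars P (m : 'X_{1..n}) : Prop :=
  forall i, m i != 0%N -> i \in P.

Lemma set_mnm_in_vars P V : mnm_in_vars P (set_mnm (V :&: P)).
Proof. by move=> i; rewrite mnmE inE eqb0 negbK => /andP[]. Qed.

Lemma mnmD_disjoint_inj P Q (m1 m2 k1 k2 : 'X_{1..n}) : [disjoint P & Q] ->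
    mnm_in_vars P m1 -> mnm_in_vars Q m2 ->
    mnm_in_vars P k1 -> mnm_in_vars Q k2 ->
  (m1 + m2 = k1 + k2)%MM -> m1 = k1 /\ m2 = k2.
Proof.
move=> disPQ m1P m2Q k1P k2Q /mnmP eq_mk.
have vanish (X : {set 'I_n}) m i : mnm_in_vars X m -> i \notin X -> m i = 0%N.
  by move=> mX iX; apply: contraNeq iX; exact: mX.
suff eq_at i : m1 i = k1 i /\ m2 i = k2 i.
  by split; apply/mnmP => i; case: (eq_at i).
have := eq_mk i; rewrite !mnmDE; have [iP|iP] := boolP (i \in P).
  have iQ : i \notin Q by rewrite (disjointFr disPQ).
  by rewrite (vanish Q m2) // (vanish Q k2) // !addn0.
by rewrite (vanish P m1) // (vanish P k1).
Qed.

Lemma mcoeffM_disjoint P Q p q V : [disjoint P & Q] ->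
    in_vars P p -> in_vars Q q ->
  (p * q)@_(set_mnm (V :&: (P :|: Q)))
    = p@_(set_mnm (V :&: P)) * q@_(set_mnm (V :&: Q)).
Proof.
move=> disPQ pP qQ; rewrite setIUr set_mnmU; last first.
  exact: disjointWl (subsetIr _ _) (disjointWr (subsetIr _ _) disPQ).
set m1 := set_mnm (V :&: P); set m2 := set_mnm (V :&: Q).
have lt1 : (mdeg m1 < (mdeg (m1 + m2)%MM).+1)%N by rewrite mdegD ltnS leq_addr.
have lt2 : (mdeg m2 < (mdeg (m1 + m2)%MM).+1)%N by rewrite mdegD ltnS leq_addl.
rewrite mcoeffM (bigD1 (BMultinom lt1, BMultinom lt2)) //= big1 ?addr0 //.
move=> [[k1 lt_k1] [k2 lt_k2]] /= /andP[/eqP eq_mk].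
apply: contraNeq; rewrite mulf_eq0 negb_or !mcoeff_eq0 !negbK.
move=> /andP[/pP k1P /qQ k2Q].
have [eq1 eq2] : m1 = k1 /\ m2 = k2.
  by apply: (mnmD_disjoint_inj disPQ) => //; apply: set_mnm_in_vars.
by apply/eqP; congr (_, _); apply/val_inj.
Qed.

Lemma mcoeff_1DXX V (i j : 'I_n) : i != j ->
  (1 + 'X_i * 'X_j : {mpoly K[n]})@_(set_mnm (V :&: [set i; j]))
    = ((i \in V) == (j \in V))%:R.
Proof.
move=> neq_ij; have dis_ij : [disjoint [set i] & [set j]].
  by rewrite disjoints1 inE.
rewrite mcoeffD mcoeff1 -mpolyXD mcoeffX -!set_mnm1 -set_mnmU // -set_mnm0.
rewrite !(inj_eq set_mnm_inj) ![_ == V :&: _]eq_sym setIC.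
rewrite (sameP eqP setIidPl) subUset !sub1set setIUl setU_eq0 !setI_eq0 !disjoints1.
by case: (i \in V); case: (j \in V); rewrite ?addr0 ?add0r.
Qed.

End DisjointVariables.

(** * Rank of the coefficient matrix *)

Lemma leq_mxrank_sum (K : fieldType) p q (I : finType) (M : I -> 'M[K]_(p, q)) :
  (\rank (\sum_i M i)%R <= \sum_i \rank (M i))%N.
Proof.
elim/big_rec2: _ => [|i r A _ le_r]; first by rewrite mxrank0.
by apply: leq_trans (mxrank_add _ _) _; rewrite leq_add2l.
Qed.

Lemma leq_mxrank_colsub (K : fieldType) m n p (g : 'I_p -> 'I_n) (A : 'M[K]_(m, n)) :
  (\rank (colsub g A) <= \rank A)%N.
Proof. by rewrite -[A in colsub g A]mulmx1 -mulmx_colsub mxrankM_maxl. Qed.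

Lemma leq_mxrank_factor (K : fieldType) p q (T : finType) (Q : {set T})
    (U : 'I_p -> T -> K) (V : T -> 'I_q -> K) :
  (\rank (\matrix_(i, j) \sum_(k in Q) U i k * V k j)%R <= #|Q|)%N.
Proof.
pose U' := \matrix_(i < p, k < #|Q|) U i (enum_val k).
pose V' := \matrix_(k < #|Q|, j < q) V (enum_val k) j.
suff -> : (\matrix_(i, j) \sum_(k in Q) U i k * V k j) = U' *m V'.
  exact: mulmx_max_rank.
apply/matrixP => i j; rewrite !mxE big_enum_val.
by apply: eq_bigr => k _; rewrite !mxE.
Qed.

Definition enum_subset (T : finType) (S : {set T}) (i : 'I_#|powerset S|) :
  {set T} := enum_val i.

Lemma enum_subset_sub (T : finType) (S : {set T}) i : @enum_subset T S i \subset S.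
Proof. by have := enum_valP i; rewrite powersetE. Qed.

Lemma enum_subset_inj (T : finType) (S : {set T}) : injective (@enum_subset T S).
Proof. exact: enum_val_inj. Qed.

Lemma enum_subset_surj (T : finType) (S V : {set T}) :
  V \subset S -> exists i : 'I_#|powerset S|, enum_subset i = V.
Proof.
rewrite -powersetE => VS; exists (enum_rank_in VS V).
exact: enum_rankK_in.
Qed.

Section CoefficientMatrix.
Variables (K : fieldType) (n : nat).
Implicit Types (p : {mpoly K[n]}) (P S : {set 'I_n}).

Definition coef_mx S p : 'M[K]_(#|powerset S|, #|powerset (~: S)|) :=
  \matrix_(i, j) p@_(set_mnm (enum_subset i :|: enum_subset j)).

Definition cut_rank S p : nat := \rank (coef_mx S p).

Lemma cut_rank_sum S (I : finType) (p : I -> {mpoly K[n]}) :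
  (cut_rank S (\sum_i p i)%R <= \sum_i cut_rank S (p i))%N.
Proof.
rewrite /cut_rank; apply: leq_trans (leq_mxrank_sum _); apply/eq_leq.
congr (\rank _); apply/matrixP => i j; rewrite mxE summxE raddf_sum.
by apply: eq_bigr => k _; rewrite mxE.
Qed.

(* Once the parts of the row outside [P] and of the column inside [P] are
   fixed, the coefficient is a product of a function of the row and a function
   of the column. *)
Lemma cut_rankM S P p q : in_vars P p -> in_vars (~: P) q ->
  (cut_rank S (p * q)%R <= 2 ^ (#|P :\: S| + #|S :\: P|))%N.
Proof.
move=> pP qP; rewrite expnD -!card_powerset -cardsX; set Q := setX _ _.
pose row_part (i : 'I_#|powerset S|) (k : {set 'I_n} * {set 'I_n}) :=
  p@_(set_mnm (enum_subset i :&: P :|: k.1)) * (enum_subset i :\: P == k.2)%:R.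
pose col_part (k : {set 'I_n} * {set 'I_n}) (j : 'I_#|powerset (~: S)|) :=
  (enum_subset j :&: P == k.1)%:R * q@_(set_mnm (k.2 :|: enum_subset j :\: P)).
suff -> : cut_rank S (p * q)
    = \rank (\matrix_(i, j) \sum_(k in Q) row_part i k * col_part k j).
  exact: leq_mxrank_factor.
congr (\rank _); apply/matrixP => i j; rewrite !mxE.
have rowS := enum_subset_sub i; have colS := enum_subset_sub j.
rewrite (bigD1 (enum_subset j :&: P, enum_subset i :\: P)) /=; last first.
  by rewrite in_setX !powersetE /= setSD // andbT setIC [P :\: S]setDE setIS.
rewrite big1 ?addr0 => [|[b a] /andP[_]]; last first.
  rewrite eq_sym xpair_eqE negb_and /row_part /col_part /=.
  by case/orP=> /negPf->; rewrite ?(mul0r, mulr0).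
rewrite /row_part /col_part !eqxx mulr1 mul1r -setIUl -setDUl setDE.
rewrite -(mcoeffM_disjoint _ _ pP qP) ?setUCr ?setIT //.
by rewrite -setI_eq0 setICr.
Qed.

(* Cutting at [P] and at [~: P] amounts to the same, so that the sign of the
   imbalance is irrelevant. *)
Lemma cut_rankM_imbalance S P p q : #|S|.*2 = n ->
    in_vars P p -> in_vars (~: P) q ->
  (cut_rank S (p * q)%R * 2 ^ imbalance S P <= 2 ^ #|S|)%N.
Proof.
move=> half_S pP qP; have qpP : in_vars (~: ~: P) p by rewrite setCK.
have := cut_rankM S qP qpP; have := cut_rankM S pP qP; rewrite [q * p]mulrC.
have cPS := cardsID S P; have cSP := cardsID P S; have cCS := cardsID S (~: P).
have cP := cardsC P; rewrite card_ord in cP.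
rewrite [S :\: ~: P]setDE setCK [P :&: S]setIC -[~: P :&: S]setIC -setDE in cPS cCS *.
have [le_PS|lt_SP] := leqP #|P| (2 * #|S :&: P|) => rank_le rank_le'.
  apply: leq_trans (leq_mul rank_le (leqnn _)) _.
  by rewrite -expnD leq_exp2l // /imbalance; lia.
apply: leq_trans (leq_mul rank_le' (leqnn _)) _.
by rewrite -expnD leq_exp2l // /imbalance; lia.
Qed.

Lemma cut_rank_sumM_imbalance S P (I : finType) (p q : I -> {mpoly K[n]}) :
    #|S|.*2 = n ->
    (forall u, in_vars P (p u)) -> (forall u, in_vars (~: P) (q u)) ->
  (cut_rank S (\sum_u p u * q u)%R * 2 ^ imbalance S P <= #|I| * 2 ^ #|S|)%N.
Proof.
move=> half_S pP qP; apply: leq_trans (leq_mul (cut_rank_sum S _) (leqnn _)) _.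
rewrite big_distrl /= -sum_nat_const; apply: leq_sum => u _.
exact: cut_rankM_imbalance.
Qed.

End CoefficientMatrix.

(** * Read-once branching programs *)

Section Walks.
Variables (A : pzSemiRingType) (d : nat) (B : abp A d).

Fixpoint walk_sum (n : nat) (u v : abp_node B) : A :=
  if n is n'.+1 then \sum_(x | abp_edge u x) abp_label u x * walk_sum n' x v
  else (u == v)%:R.

Lemma sum_path_walk_sum n u v :
  \sum_(p : n.-tuple (abp_node B) | path (@abp_edge _ _ B) u p && (last u p == v))
     \prod_(a <- pairmap (@abp_label _ _ B) u p) a = walk_sum n u v.
Proof.
elim: n u => [|n IH] u /=.
  rewrite (eq_bigr (fun=> 1)); last by move=> p _; rewrite (tuple0 p) big_nil.
  rewrite (eq_bigl (fun=> u == v)); last by move=> p; rewrite (tuple0 p).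
  case: (u == v); last by rewrite big_pred0.
  by rewrite big_const card_tuple expn0 /= addr0.
under [RHS]eq_bigr => x _ do rewrite -IH big_distrr /=.
rewrite pair_big_dep /=.
rewrite (reindex (fun xp : abp_node B * n.-tuple _ => [tuple of xp.1 :: xp.2])) /=.
  by apply: eq_big => -[x p] /=; rewrite ?andbA // big_cons.
exists (fun p : n.+1.-tuple _ => (thead p, [tuple of behead p])) => [[x p] _|p _] /=.
  by congr (_, _); apply/val_inj.
by rewrite [RHS]tuple_eta; apply/val_inj.
Qed.

Lemma walk_sumD a b u v :
  walk_sum (a + b) u v = \sum_x walk_sum a u x * walk_sum b x v.
Proof.
elim: a u => [|a IH] u /=.
  rewrite (bigD1 u) //= eqxx mul1r big1 ?addr0 // => x.
  by rewrite eq_sym => /negPf->; rewrite mul0r.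
under eq_bigr => x _ do rewrite IH big_distrr /=.
rewrite exchange_big /=; apply: eq_bigr => x _; rewrite big_distrl /=.
by apply: eq_bigr => y _; rewrite mulrA.
Qed.

Lemma walk_sum_off_layer n u v :
  abp_layer v != (abp_layer u + n)%N :> nat -> walk_sum n u v = 0.
Proof.
elim: n u => [|n IH] u /=.
  by rewrite addn0; case: (eqVneq u v) => // ->; rewrite eqxx.
move=> neq; apply: big1 => x /abp_edge_layer layer_x.
by rewrite IH ?mulr0 // layer_x addSnnS.
Qed.

Lemma abp_eval_walk_sum : abp_eval B = walk_sum d (abp_src B) (abp_snk B).
Proof. exact: sum_path_walk_sum. Qed.

End Walks.

Definition read_once_over (K : fieldType) (N d : nat) (X : 'I_d -> {set 'I_N})
    (B : abp {mpoly K[N]} d) : Prop :=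
  equipartition X /\
  forall (i : 'I_d) (u v : abp_node B), abp_edge u v ->
    abp_layer u = i :> nat -> in_vars (X i) (abp_label u v).

Lemma sparse_roabp_read_once (K : fieldType) (N t d : nat) (B : abp {mpoly K[N]} d) :
  sparse_roabp t B -> exists X, read_once_over X B.
Proof.
case=> X [equiX labelX]; exists X; split=> // i u v uv layer_u.
by case: (labelX i u v uv layer_u).
Qed.

Section ReadOnce.
Variables (K : fieldType) (N d : nat) (B : abp {mpoly K[N]} d).
Variable X : 'I_d -> {set 'I_N}.
Hypothesis readX : read_once_over X B.

Lemma walk_sum_in_vars (Q : {set 'I_N}) n (u v : abp_node B) :
    (forall i : 'I_d, abp_layer u <= i < abp_layer u + n -> X i \subset Q)%N ->
  in_vars Q (walk_sum n u v).
Proof.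
elim: n u => [|n IH] u subQ /=.
  by case: (u == v); [exact: in_vars1|exact: in_vars0].
apply: in_vars_sum => x ux; have layer_x := abp_edge_layer ux.
have lt_ud : (abp_layer u < d)%N by have := ltn_ord (abp_layer x); lia.
apply: in_varsM; last by apply: IH => i i_x; apply: subQ; lia.
apply: in_varsS (readX.2 _ _ _ ux (erefl : _ = Ordinal lt_ud :> nat)).
by apply: subQ => /=; lia.
Qed.

Definition vars_before a : {set 'I_N} := \bigcup_(i < d | (i < a)%N) X i.

Lemma vars_before_homo :
  {homo vars_before : a b / (a <= b)%N >-> a \subset b}.
Proof.
move=> a b le_ab; apply/bigcupsP => i lt_ia; apply: (bigcup_sup i) => //.
exact: leq_trans le_ab.
Qed.

Lemma disjoint_vars_before a (i : 'I_d) : (a <= i)%N ->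
  [disjoint X i & vars_before a].
Proof.
have [disX _ _] := readX.1.
move=> le_ai; apply/bigcup_disjointP => j lt_ja; apply: disX.
by rewrite -val_eqE /=; lia.
Qed.

Lemma card_vars_before a : (a <= d)%N -> (#|vars_before a| * d = a * N)%N.
Proof.
have [_ _ cardX] := readX.1.
elim: a => [|a IH] lt_ad; first by rewrite /vars_before big_pred0 ?cards0.
have -> : vars_before a.+1 = X (Ordinal lt_ad) :|: vars_before a.
  rewrite /vars_before (bigD1 (Ordinal lt_ad)) //=; congr (_ :|: _).
  by apply: eq_bigl => i; rewrite -val_eqE /=; lia.
have := disjoint_vars_before (leqnn (Ordinal lt_ad : 'I_d)).
rewrite /= -leq_card_setU => /eqP->.
by rewrite mulnDl cardX IH ?(ltnW lt_ad) // mulSn.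
Qed.

Lemma card_vars_between a b : (a <= b <= d)%N ->
  (#|vars_before b :\: vars_before a| * d = (b - a) * N)%N.
Proof.
case/andP=> le_ab le_bd; rewrite cardsD (setIidPr (vars_before_homo le_ab)).
by rewrite mulnBl !card_vars_before ?(leq_trans le_ab) // mulnBl.
Qed.

Lemma abp_eval_cut a : (a <= d)%N ->
  exists p q : abp_node B -> {mpoly K[N]},
    [/\ abp_eval B = \sum_u p u * q u,
        forall u, in_vars (vars_before a) (p u)
      & forall u, in_vars (~: vars_before a) (q u)].
Proof.
move=> le_ad; exists (walk_sum a (abp_src B)).
exists (fun u => if abp_layer u == a :> nat
                 then walk_sum (d - a) u (abp_snk B) else 0).
split=> [|u|u].
- rewrite abp_eval_walk_sum -[d in walk_sum d](subnKC le_ad) walk_sumD.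
  apply: eq_bigr => u _; case: eqVneq => // neq.
  by rewrite walk_sum_off_layer ?mul0r ?mulr0 // abp_src_layer.
- apply: walk_sum_in_vars => i; rewrite abp_src_layer add0n => lt_ia.
  exact: (bigcup_sup i).
- case: eqVneq => [layer_u|_]; last exact: in_vars0.
  apply: walk_sum_in_vars => i; rewrite layer_u => /andP[le_ai _].
  by rewrite -disjoints_subset disjoint_vars_before.
Qed.

Definition cut_vars r a : {set 'I_N} := vars_before (a * (d %/ r)).

Lemma leq_mul_divn r a : (a <= r)%N -> (a * (d %/ r) <= d)%N.
Proof. by move=> le_ar; apply: leq_trans (leq_divM d r); rewrite mulnC leq_mul. Qed.

Lemma card_cut_vars_chunk r b a :
    (0 < r <= d)%N -> (32 * b ^ 2 * r <= N)%N -> (a < r)%N ->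
  (16 * b ^ 2 <= #|cut_vars r a.+1 :\: cut_vars r a|)%N.
Proof.
case/andP=> r_gt0 le_rd large_N lt_ar; set q := (d %/ r)%N.
have d_gt0 : (0 < d)%N by apply: leq_trans le_rd.
have q_gt0 : (0 < q)%N by rewrite divn_gt0.
have lt_d : (d < q.+1 * r)%N by apply: ltn_ceil.
have le_q : (a * q <= a.+1 * q <= d)%N by rewrite leq_mul2r leqnSn orbT leq_mul_divn.
rewrite -(leq_pmul2r d_gt0) card_vars_between // -mulnBl subSnn mul1n.
apply: (@leq_trans (q * (32 * b ^ 2 * r))); last by rewrite leq_mul2l large_N orbT.
apply: (@leq_trans (16 * b ^ 2 * (2 * q * r))); last by rewrite [leqRHS]mulnCA; lia.
by rewrite leq_mul2l; apply/orP; right; nia.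
Qed.

Lemma card_roabp_near_even_sets r b :
    (0 < r <= d)%N -> (32 * b ^ 2 * r <= N)%N ->
  (#|near_even_sets (cut_vars r) b r| * 2 ^ r <= 2 ^ N)%N.
Proof.
move=> r_itv large_N; rewrite -[N in leqRHS]card_ord.
apply: card_near_even_sets => [a a' le_a|a]; last exact: card_cut_vars_chunk.
by apply: vars_before_homo; rewrite leq_mul2r le_a orbT.
Qed.

Lemma roabp_cut_rank r b (S : {set 'I_N}) : #|S|.*2 = N ->
    S \notin near_even_sets (cut_vars r) b r ->
  (cut_rank S (abp_eval B) * 2 ^ b <= abp_size B * 2 ^ #|S|)%N.
Proof.
move=> half_S; rewrite inE negb_forall => /existsP[a]; rewrite -leqNgt => le_b.
have [p [q [-> pP qP]]] := abp_eval_cut (leq_mul_divn (leq_ord a)).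
apply: leq_trans (cut_rank_sumM_imbalance half_S pP qP).
by rewrite leq_mul2l leq_exp2l ?le_b ?orbT.
Qed.

End ReadOnce.

(** * Leading coefficients of determinants *)

Lemma coefM_top (A : nzSemiRingType) (p q : {poly A}) m n :
    (size p <= m.+1)%N -> (size q <= n.+1)%N ->
  (p * q)`_(m + n) = p`_m * q`_n.
Proof.
move=> size_p size_q; have lt_m : (m < (m + n).+1)%N by rewrite ltnS leq_addr.
rewrite coefM (bigD1 (Ordinal lt_m)) //= addKn big1 ?addr0 // => i.
rewrite -val_eqE /= neq_ltn => /orP[lt_im|lt_mi].
  by rewrite [q`__]nth_default ?mulr0 //; apply: leq_trans size_q _; lia.
by rewrite nth_default ?mul0r //; apply: leq_trans size_p _.
Qed.

Lemma size_mul_top (A : nzSemiRingType) (p q : {poly A}) m n :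
  (size p <= m.+1)%N -> (size q <= n.+1)%N -> (size (p * q)%R <= (m + n).+1)%N.
Proof. by move=> size_p size_q; apply: leq_trans (size_polyMleq _ _) _; lia. Qed.

Section TopCoefficientProd.
Variables (A : nzSemiRingType) (I : Type) (p : I -> {poly A}) (E : I -> nat).
Hypothesis size_p : forall i, (size (p i) <= (E i).+1)%N.

Lemma size_prod_top (r : seq I) :
  (size (\prod_(i <- r) p i)%R <= (\sum_(i <- r) E i).+1)%N.
Proof.
elim/big_rec2: _ => [|i e q _ size_q]; first by rewrite size_poly1.
exact: size_mul_top.
Qed.

Lemma coef_prod_top (r : seq I) :
  (\prod_(i <- r) p i)`_(\sum_(i <- r) E i) = \prod_(i <- r) (p i)`_(E i).
Proof.
elim: r => [|i r IH]; first by rewrite !big_nil coefC.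
by rewrite !big_cons coefM_top ?size_prod_top // IH.
Qed.

End TopCoefficientProd.

Lemma coef_det_top (A : comNzRingType) n (M : 'M[{poly A}]_n) (E : 'I_n -> nat) :
    (forall i j, size (M i j) <= (E i).+1)%N ->
  (\det M)`_(\sum_i E i) = \det (\matrix_(i, j) (M i j)`_(E i)).
Proof.
move=> size_M; rewrite /determinant coef_sum; apply: eq_bigr => s _.
rewrite !mulr_sign.
have -> : \prod_i (\matrix_(i, j) (M i j)`_(E i)) i (s i)
    = \prod_i (M i (s i))`_(E i) by apply: eq_bigr => i _; rewrite mxE.
rewrite -(coef_prod_top (fun i => size_M i (s i))).
by case: (s : bool); rewrite ?coefN.
Qed.

(** * Coefficients of the Raz-Yehudayoff recursion *)

(* [a] encodes a multilinear monomial in the 1-based variables, and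
   [ry_coef w n i j a] is its coefficient in the polynomial g_{i,j} of weights
   [w], only the indices in [i, j] being relevant. *)
Fixpoint ry_coef (A : pzRingType) (w : nat -> nat -> nat -> A) (n i j : nat)
    (a : nat -> bool) : A :=
  if n is n'.+1 then
    if itv_len i j == 0%N then 1
    else (a i == a j)%:R * ry_coef w n' i.+1 j.-1 a
         + \sum_(i.+1 <= k < j.-1 | ~~ odd (itv_len i k))
             w i k j * (ry_coef w n' i k a * ry_coef w n' k.+1 j a)
  else 1.

Lemma rmorph_ry_coef (A B : pzRingType) (f : {rmorphism A -> B}) w n i j a :
  f (ry_coef w n i j a) = ry_coef (fun i k j => f (w i k j)) n i j a.
Proof.
elim: n i j => [|n IH] i j /=; first by rewrite rmorph1.
case: ifP => _; first by rewrite rmorph1.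
rewrite rmorphD rmorphM rmorph_nat IH rmorph_sum; congr (_ + _).
by apply: eq_bigr => k _; rewrite !rmorphM !IH.
Qed.

Lemma eq_ry_coef (A : pzRingType) (w w' : nat -> nat -> nat -> A) lo hi n i j a :
    (forall i k j, lo <= i -> i < k < j -> j <= hi -> w i k j = w' i k j)%N ->
    (lo <= i)%N -> (j <= hi)%N ->
  ry_coef w n i j a = ry_coef w' n i j a.
Proof.
move=> eq_w; elim: n i j => [//|n IH] i j lo_i j_hi /=.
case: ifP => // _; rewrite IH ?(leqW lo_i) //; last by lia.
congr (_ + _); rewrite big_nat_cond [RHS]big_nat_cond.
by apply: eq_bigr => k /andP[k_itv _]; rewrite eq_w ?IH //; lia.
Qed.

(** * Balanced intervals and noncrossing matchings *)

Lemma discrete_ivt (f : nat -> int) m n : (m <= n)%N ->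
    (forall k, `|f k.+1 - f k| <= 1) -> f m <= 0 -> 0 <= f n ->
  exists2 k, (m <= k <= n)%N & f k = 0.
Proof.
move=> le_mn small_step f_m f_n.
have ex_nonneg : exists k, (m <= k)%N && (0 <= f k) by exists n; rewrite le_mn.
case: (ex_minnP ex_nonneg) => k /andP[le_mk f_k] min_k.
have le_kn : (k <= n)%N by apply: min_k; rewrite le_mn.
exists k; first by rewrite le_mk.
have [eq_mk|neq_mk] := eqVneq m k; first by apply/eqP; rewrite eq_le f_k -eq_mk f_m.
have f_pred : f k.-1 < 0.
  rewrite ltNge; apply/negP => f_pred; have := min_k k.-1.
  by rewrite f_pred andbT; lia.
by have := small_step k.-1; rewrite prednK; lia.
Qed.

Section Balanced.
Variable s : nat -> bool.

Definition excess i j : int := \sum_(i <= x < j.+1) (-1) ^+ s x.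

Definition balanced i j : bool := excess i j == 0.

Lemma excess1 i : excess i i = (-1) ^+ s i.
Proof. by rewrite /excess big_nat1. Qed.

Lemma excess_cat i k j : (i <= k.+1)%N -> (k <= j)%N ->
  excess i j = excess i k + excess k.+1 j.
Proof. by move=> le_ik le_kj; rewrite /excess (@big_cat_nat _ _ _ k.+1). Qed.

Lemma excess_count i j :
  excess i j = (itv_len i j)%:Z - (2 * \sum_(i <= x < j.+1) s x)%N%:Z.
Proof.
rewrite /itv_len -[(j.+1 - i)%N]muln1 -sum_nat_const_nat big_distrr /=.
rewrite !(big_morph Posz PoszD (erefl _)) -sumrB.
by apply: eq_bigr => x _; case: (s x).
Qed.

Lemma balanced_even i j : balanced i j -> ~~ odd (itv_len i j).
Proof.
rewrite /balanced excess_count subr_eq0 => /eqP[->].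
by rewrite mul2n odd_double.
Qed.

Lemma balanced_cat i k j : (i <= k.+1)%N -> (k <= j)%N ->
  balanced i k -> balanced i j -> balanced k.+1 j.
Proof.
move=> le_ik le_kj; rewrite /balanced (excess_cat le_ik le_kj) => /eqP->.
by rewrite add0r.
Qed.

Lemma excess_last i j : (i < j)%N -> excess i j = excess i j.-1 + (-1) ^+ s j.
Proof.
by move=> lt_ij; rewrite (@excess_cat i j.-1 j) ?prednK ?excess1 //; lia.
Qed.

Lemma excess_ends i j : (i < j)%N ->
  excess i j = (-1) ^+ s i + excess i.+1 j.-1 + (-1) ^+ s j.
Proof.
move=> lt_ij; have le_ij : (i <= j.-1)%N by lia.
by rewrite excess_last // (@excess_cat i i j.-1) // excess1.
Qed.

Lemma balanced_inner i j : (i < j)%N -> s i != s j ->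
  balanced i j -> balanced i.+1 j.-1.
Proof.
move=> lt_ij neq_s; rewrite /balanced excess_ends //.
by case: (s i) (s j) neq_s => [] [] //= _ /eqP; lia.
Qed.

Lemma excess_step i k : `|excess i k.+1 - excess i k| <= 1.
Proof.
rewrite /excess; have [le_ik|lt_ki] := leqP i k.+1; last first.
  by rewrite !big_geq ?subrr // ltnW.
by rewrite big_nat_recr //= addrAC subrr add0r normrX normrN1 expr1n.
Qed.

(* The excess of [i, k] is (-1)^(s i) at k = i and its opposite at k = j - 1. *)
Lemma balanced_split i j : (i < j)%N -> s i = s j -> balanced i j ->
  exists2 k, (i < k < j.-1)%N & balanced i k.
Proof.
move=> lt_ij eq_s /eqP bal; pose e : int := (-1) ^+ s i.
have ee : e * e = 1 by rewrite -expr2 sqrr_sign.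
have excess_i : - e * excess i i = -1 by rewrite excess1 mulNr ee.
have excess_j : - e * excess i j.-1 = 1.
  have -> : excess i j.-1 = - e; last by rewrite mulrNN ee.
  by apply/eqP; rewrite -addr_eq0 /e eq_s -excess_last // bal.
have [|k|||k k_itv] := @discrete_ivt (fun k => - e * excess i k) i j.-1.
- by lia.
- by rewrite -mulrBr normrM normrN normrX normrN1 expr1n mul1r excess_step.
- by rewrite excess_i.
- by rewrite excess_j.
move=> excess_k; exists k; last first.
  by move/eqP: excess_k; rewrite mulf_eq0 oppr_eq0 signr_eq0.
have neq_ki : k != i by apply: contra_eq_neq excess_k => ->; rewrite excess_i.
have neq_kj : k != j.-1 by apply: contra_eq_neq excess_k => ->; rewrite excess_j.
lia.
Qed.

End Balanced.

Section Matchings.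
Implicit Types (s a : nat -> bool) (p : nat -> nat).

Definition matching s p i j : Prop :=
  forall x, (i <= x <= j)%N ->
    [/\ (i <= p x <= j)%N, s (p x) = ~~ s x & p (p x) = x].

Definition equal_on_pairs p i j a : bool :=
  all (fun x => a (p x) == a x) (index_iota i j.+1).

Lemma equal_on_pairsP p i j a :
  reflect (forall x, (i <= x <= j)%N -> a (p x) = a x) (equal_on_pairs p i j a).
Proof.
apply: (iffP allP) => eq_a x; last by rewrite mem_index_iota ltnS => /eq_a->.
by move=> x_itv; apply/eqP/eq_a; rewrite mem_index_iota.
Qed.

Definition nest_matching i j p (x : nat) : nat :=
  if x == i then j else if x == j then i else p x.

Lemma nest_matchingP s i j p : (i < j)%N -> s i != s j ->
  matching s p i.+1 j.-1 -> matching s (nest_matching i j p) i j.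
Proof.
rewrite /nest_matching => lt_ij neq_s match_p x x_itv.
have s_j : s j = ~~ s i by case: (s i) (s j) neq_s => [] [].
have [->|x_i] := eqVneq x i; first by rewrite gtn_eqF // eqxx s_j; split=> //; lia.
have [->|x_j] := eqVneq x j; first by rewrite eqxx s_j negbK; split=> //; lia.
have [|p_itv s_p p_p] := match_p x; first by lia.
by rewrite gtn_eqF ?ltn_eqF //; [split=> //|..]; lia.
Qed.

Lemma equal_on_pairs_nest i j p a : (i < j)%N ->
  equal_on_pairs (nest_matching i j p) i j a
    = (a i == a j) && equal_on_pairs p i.+1 j.-1 a.
Proof.
move=> lt_ij; rewrite /nest_matching.
apply/equal_on_pairsP/andP => [eq_a|[/eqP eq_ij /equal_on_pairsP eq_a] x x_itv].
  split; first by have := eq_a i; rewrite eqxx => ->; rewrite ?eqxx //; lia.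
  apply/equal_on_pairsP => x x_itv; have := eq_a x.
  by rewrite gtn_eqF ?ltn_eqF; [apply|..]; lia.
have [->//|x_i] := eqVneq x i; have [->//|x_j] := eqVneq x j.
by apply: eq_a; lia.
Qed.

Definition join_matching k p q (x : nat) : nat :=
  if (x <= k)%N then p x else q x.

Lemma join_matchingP s i k j p q : (i <= k.+1)%N -> (k <= j)%N ->
    matching s p i k -> matching s q k.+1 j ->
  matching s (join_matching k p q) i j.
Proof.
rewrite /join_matching => le_ik le_kj match_p match_q x x_itv.
have [le_xk|lt_kx] := leqP x k.
  have [|p_itv s_p p_p] := match_p x; first by lia.
  by have -> : (p x <= k)%N by [lia]; split=> //; lia.
have [|q_itv s_q q_q] := match_q x; first by lia.
by have -> : (q x <= k)%N = false by [lia]; split=> //; lia.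
Qed.

Lemma equal_on_pairs_join i k j p q a : (i <= k.+1)%N -> (k <= j)%N ->
  equal_on_pairs (join_matching k p q) i j a
    = equal_on_pairs p i k a && equal_on_pairs q k.+1 j a.
Proof.
rewrite /join_matching => le_ik le_kj.
apply/equal_on_pairsP/andP
    => [eq_a|[/equal_on_pairsP eq_p /equal_on_pairsP eq_q] x x_itv].
  split; apply/equal_on_pairsP => x x_itv; have := eq_a x.
    by have -> : (x <= k)%N by [lia]; apply; lia.
  by have -> : (x <= k)%N = false by [lia]; apply; lia.
by have [le_xk|lt_kx] := leqP x k; [apply: eq_p|apply: eq_q]; lia.
Qed.

End Matchings.

Section LeadingTerm.
Variables (A : nzRingType) (s : nat -> bool).

Definition split_point i j : nat :=
  (i.+1 + find (balanced s i) (index_iota i.+1 j.-1))%N.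

Lemma split_pointP i j : (i < j)%N -> s i = s j -> balanced s i j ->
  (i < split_point i j < j.-1)%N /\ balanced s i (split_point i j).
Proof.
move=> lt_ij eq_s bal; have [k k_itv bal_k] := balanced_split lt_ij eq_s bal.
have has_k : has (balanced s i) (index_iota i.+1 j.-1).
  by apply/hasP; exists k => //; rewrite mem_index_iota.
have := nth_find 0%N has_k; rewrite has_find size_iota in has_k.
by rewrite nth_iota // -/(split_point i j); split=> //; rewrite /split_point; lia.
Qed.

(* Powers of the indeterminate fast enough for the chosen split of an interval
   to dominate every other contribution. *)
Definition split_weight i k j : {poly A} :=
  if (s i == s j) && (k == split_point i j) then 'X^(4 ^ itv_len i j) else 0.

Lemma size_split_weight i k j :
  (size (split_weight i k j) <= (4 ^ itv_len i j).+1)%N.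
Proof. by rewrite /split_weight; case: ifP; rewrite ?size_polyXn ?size_poly0. Qed.

Local Notation coef := (ry_coef split_weight).

Lemma size_ry_coef n i j a : (size (coef n i j a) <= 2 * 4 ^ itv_len i j)%N.
Proof.
have size1 m : (size (1%R : {poly A}) <= 2 * 4 ^ m)%N.
  by rewrite size_poly1 muln_gt0 expn_gt0.
elim: n i j => [|n IH] i j /=; first exact: size1.
case: ifP => [_|/negbT len]; first exact: size1.
apply: leq_trans (size_polyD _ _) _; rewrite geq_max; apply/andP; split.
  case: eqP => _; last by rewrite mul0r size_poly0.
  rewrite mul1r; apply: leq_trans (IH _ _) _.
  by rewrite leq_mul2l leq_exp2l // /itv_len; lia.
rewrite big_nat_cond; elim/big_rec: _ => [|k p /andP[k_itv _] size_p].
  by rewrite size_poly0.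
apply: leq_trans (size_polyD _ _) _; rewrite geq_max size_p andbT.
have small i' j' : (itv_len i' j' + 2 <= itv_len i j)%N ->
    (8 * size (coef n i' j' a) <= 4 ^ itv_len i j)%N.
  move=> /(@leq_pexp2l 4 _ _ isT); apply: leq_trans.
  by rewrite expnD; have := IH i' j'; lia.
have small1 := small i k ltac:(rewrite /itv_len; lia).
have small2 := small k.+1 j ltac:(rewrite /itv_len; lia).
have size_tail : (size (coef n i k a * coef n k.+1 j a)%R <= 4 ^ itv_len i j)%N.
  by apply: leq_trans (size_polyMleq _ _) _; lia.
apply: leq_trans (size_polyMleq _ _) _.
by have := leq_add (size_split_weight i k j) size_tail; lia.
Qed.

Definition has_leading_matching n i j (E : nat) (p : nat -> nat) : Prop :=
  forall a, (size (coef n i j a) <= E.+1)%N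
    /\ (coef n i j a)`_E = (equal_on_pairs p i j a)%:R.

Lemma ry_coef_empty n i j a : itv_len i j = 0%N -> coef n i j a = 1.
Proof. by case: n => //= n ->. Qed.

Lemma empty_leading_matching n i j p : itv_len i j = 0%N ->
  matching s p i j /\ has_leading_matching n i j 0 p.
Proof.
rewrite /itv_len => len; split=> [x|a]; first by lia.
rewrite ry_coef_empty // size_poly1 coefC.
by rewrite /equal_on_pairs /index_iota len.
Qed.

Lemma ry_coef_nest n i j a : (i < j)%N -> s i != s j ->
  coef n.+1 i j a = (a i == a j)%:R * coef n i.+1 j.-1 a.
Proof.
move=> lt_ij neq_s; rewrite /= ifF; last by rewrite /itv_len; lia.
rewrite big1 ?addr0 // => k _.
by rewrite /split_weight (negPf neq_s) mul0r.
Qed.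

Lemma ry_coef_split n i j a : (i < j)%N -> s i = s j -> balanced s i j ->
  coef n.+1 i j a = (a i == a j)%:R * coef n i.+1 j.-1 a
    + 'X^(4 ^ itv_len i j) * (coef n i (split_point i j) a
                              * coef n (split_point i j).+1 j a).
Proof.
move=> lt_ij eq_s bal; have [k_itv bal_k] := split_pointP lt_ij eq_s bal.
rewrite /= ifF; last by rewrite /itv_len; lia.
congr (_ + _); rewrite big_mkcond.
rewrite (bigD1_seq (split_point i j)) ?iota_uniq ?mem_index_iota //=.
rewrite (balanced_even bal_k) /split_weight eq_s !eqxx big1 ?addr0 // => k neq_k.
by rewrite (negPf neq_k) andbF mul0r if_same.
Qed.

Lemma nest_leading_matching n i j E p : (i < j)%N -> s i != s j ->
    has_leading_matching n i.+1 j.-1 E p ->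
  has_leading_matching n.+1 i j E (nest_matching i j p).
Proof.
move=> lt_ij neq_s lead_p a; have [size_p coef_p] := lead_p a.
rewrite ry_coef_nest // equal_on_pairs_nest //.
by case: eqP => _; rewrite ?mul1r // mul0r size_poly0 coef0.
Qed.

Lemma join_leading_matching n i j E1 E2 p q (k := split_point i j) :
    (i < j)%N -> s i = s j -> balanced s i j ->
    has_leading_matching n i k E1 p -> has_leading_matching n k.+1 j E2 q ->
  has_leading_matching n.+1 i j (4 ^ itv_len i j + (E1 + E2)) (join_matching k p q).
Proof.
move=> lt_ij eq_s bal lead_p lead_q a.
have [k_itv _] := split_pointP lt_ij eq_s bal; rewrite -/k in k_itv.
have [size_p coef_p] := lead_p a; have [size_q coef_q] := lead_q a.
rewrite ry_coef_split // -/k equal_on_pairs_join; try lia.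
have size_inner :
    (size ((a i == a j)%:R * coef n i.+1 j.-1 a)%R <= 4 ^ itv_len i j)%N.
  case: eqP => _; last by rewrite mul0r size_poly0.
  rewrite mul1r; apply: leq_trans (size_ry_coef _ _ _ _) _.
  apply: (@leq_trans (4 * 4 ^ itv_len i.+1 j.-1)); first by rewrite leq_mul2r orbT.
  by rewrite -expnS leq_exp2l // /itv_len; lia.
have size_pq := size_mul_top size_p size_q; split.
  apply: leq_trans (size_polyD _ _) _; rewrite geq_max; apply/andP; split.
    by apply: leq_trans size_inner _; lia.
  by apply: size_mul_top size_pq; rewrite size_polyXn.
rewrite coefD nth_default ?add0r; last by apply: leq_trans size_inner _; lia.
by rewrite coefXnM ltnNge leq_addr addKn coefM_top // coef_p coef_q -natrM mulnb.
Qed.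

Lemma exists_leading_matching n i j :
    (itv_len i j <= n)%N -> balanced s i j ->
  exists E p, matching s p i j /\ has_leading_matching n i j E p.
Proof.
elim: n i j => [|n IH] i j len_n bal.
  by exists 0%N, id; apply: empty_leading_matching; lia.
have [len0|len_neq0] := eqVneq (itv_len i j) 0%N.
  by exists 0%N, id; apply: empty_leading_matching.
have lt_ij : (i < j)%N.
  by have := balanced_even bal; move: len_neq0; rewrite /itv_len; lia.
rewrite /itv_len in len_n; have [eq_s|neq_s] := eqVneq (s i) (s j).
  have [k_itv bal_k] := split_pointP lt_ij eq_s bal.
  have [|E1 [p [match_p lead_p]]] := IH i (split_point i j) _ bal_k.
    by rewrite /itv_len; lia.
  have [||E2 [q [match_q lead_q]]] := IH (split_point i j).+1 j.
  - by rewrite /itv_len; lia.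
  - by apply: balanced_cat bal_k bal; lia.
  exists (4 ^ itv_len i j + (E1 + E2))%N, (join_matching (split_point i j) p q).
  by split; [apply: join_matchingP => //; lia|apply: join_leading_matching].
have [||E [p [match_p lead_p]]] := IH i.+1 j.-1.
- by rewrite /itv_len; lia.
- exact: balanced_inner.
exists E, (nest_matching i j p).
by split; [apply: nest_matchingP|apply: nest_leading_matching].
Qed.

End LeadingTerm.

(** * Full rank of the Raz-Yehudayoff polynomial *)

Section IndexSets.
Variable N : nat.
Implicit Types (S V W : {set 'I_N}).

Definition itv_set i j : {set 'I_N} := [set o : 'I_N | i <= o.+1 <= j]%N.

Lemma itv_set0 i j : itv_len i j = 0%N -> itv_set i j = set0.
Proof. by rewrite /itv_len => len; apply/setP => o; rewrite !inE; lia. Qed.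

Lemma itv_setT : itv_set 1 N = setT.
Proof. by apply/setP => o; rewrite !inE ltn_ord. Qed.

Lemma itv_setS i j i' j' : (i' <= i)%N -> (j <= j')%N ->
  itv_set i j \subset itv_set i' j'.
Proof. by move=> le_i le_j; apply/subsetP => o; rewrite !inE; lia. Qed.

Lemma itv_setU i k j : (i <= k.+1)%N -> (k <= j)%N ->
  itv_set i j = itv_set i k :|: itv_set k.+1 j.
Proof. by move=> le_ik le_kj; apply/setP => o; rewrite !inE; lia. Qed.

Lemma disjoint_itv_set i k j : [disjoint itv_set i k & itv_set k.+1 j].
Proof. by rewrite -setI_eq0; apply/eqP/setP => o; rewrite !inE; lia. Qed.

Lemma itv_set_ends (o o' : 'I_N) : (o < o')%N ->
  itv_set o.+1 o'.+1 = [set o; o'] :|: itv_set o.+2 o'.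
Proof. by move=> lt_o; apply/setP => x; rewrite !inE -!val_eqE /=; lia. Qed.

Lemma disjoint_itv_set_ends (o o' : 'I_N) : [disjoint [set o; o'] & itv_set o.+2 o'].
Proof.
by rewrite -setI_eq0; apply/eqP/setP => x; rewrite !inE -!val_eqE /=; lia.
Qed.

Lemma index_ordP i : (0 < i <= N)%N -> exists o : 'I_N, i = o.+1.
Proof. by case: i => // i lt_iN; exists (Ordinal lt_iN). Qed.

Definition mem_index V (x : nat) : bool :=
  if ord_of_index N x is Some o then o \in V else false.

Lemma mem_indexE V (o : 'I_N) : mem_index V o.+1 = (o \in V).
Proof. by rewrite /mem_index /= valK. Qed.

Lemma balanced_mem_index S : #|S|.*2 = N -> balanced (mem_index S) 1 N.
Proof.
move=> half_S; rewrite /balanced excess_count /itv_len subSS subn0.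
rewrite big_add1 /= big_mkord.
rewrite (eq_bigr (fun o : 'I_N => (o \in S : nat))) => [|o _]; last first.
  by rewrite mem_indexE.
by rewrite -big_mkcond sum1_card mul2n half_S subrr.
Qed.

Lemma matching_involution S p : matching (mem_index S) p 1 N ->
  exists2 pi : 'I_N -> 'I_N, forall o : 'I_N, p o.+1 = (pi o).+1
    & involutive pi /\ pi @^-1: S = ~: S.
Proof.
move=> match_p; have match_ord (o : 'I_N) := match_p o.+1 (ltn_ord o).
have [o|pi p_pi] := @fin_all_exists 'I_N (fun=> 'I_N) (fun o o' => p o.+1 = o'.+1).
  by apply: index_ordP; case: (match_ord o).
exists pi => //; split=> [o|].
  by apply/val_inj/succn_inj; rewrite -!p_pi; case: (match_ord o).
apply/setP => o; rewrite !inE -(mem_indexE S (pi o)) -p_pi -(mem_indexE S o).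
by case: (match_ord o).
Qed.

Lemma equal_on_pairs_preimset p (pi : 'I_N -> 'I_N) V :
    (forall o : 'I_N, p o.+1 = (pi o).+1) ->
  equal_on_pairs p 1 N (mem_index V) = (pi @^-1: V == V).
Proof.
move=> p_pi; apply/equal_on_pairsP/eqP => [eq_V|eq_V x /index_ordP[o ->]].
  apply/setP => o; rewrite inE.
  by have := eq_V o.+1 (ltn_ord o); rewrite p_pi !mem_indexE.
by rewrite p_pi !mem_indexE -[in RHS]eq_V inE.
Qed.

Lemma preimset_swap_eq S (pi : 'I_N -> 'I_N) V W :
    involutive pi -> pi @^-1: S = ~: S -> V \subset S -> W \subset S ->
  (pi @^-1: (V :|: pi @^-1: W) == V :|: pi @^-1: W) = (V == W).
Proof.
move=> piK swap_S sVS sWS.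
have pi_preK (U : {set 'I_N}) : pi @^-1: (pi @^-1: U) = U.
  by apply/setP => o; rewrite !inE piK.
have off_S (U : {set 'I_N}) : U \subset S -> pi @^-1: U :&: S = set0.
  move=> sUS; apply/eqP; rewrite setI_eq0 disjoints_subset -swap_S.
  exact: preimsetS.
rewrite preimsetU pi_preK.
apply/eqP/eqP => [/(congr1 (setI S))|->]; last exact: setUC.
rewrite !(setIC S) !setIUl !off_S // set0U setU0.
by rewrite (setIidPl sVS) (setIidPl sWS).
Qed.

End IndexSets.

Section RyCoefficients.
Variables (F : fieldType) (N : nat).
Implicit Types V : {set 'I_N}.

Lemma xvar_ord (o : 'I_N) : xvar F N o.+1 = 'X_o.
Proof. by rewrite /xvar /= valK. Qed.

Lemma xvar_in_vars i j x : (i <= x <= j)%N -> in_vars (itv_set N i j) (xvar F N x).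
Proof.
move=> x_itv; case: x x_itv => [|x] x_itv; first exact: in_vars0.
rewrite /xvar /=; case: insubP => [o _ val_o|_]; last exact: in_vars0.
by apply: in_varsX; rewrite inE val_o.
Qed.

Lemma ry_rec_in_vars n i j : in_vars (itv_set N i j) (ry_rec F N n i j).
Proof.
elim: n i j => [|n IH] i j /=; first exact: in_vars1.
case: eqP => [_|len]; first exact: in_vars1.
have sub i' j' : (i <= i')%N -> (j' <= j)%N ->
    in_vars (itv_set N i j) (ry_rec F N n i' j').
  by move=> le_i le_j; apply: in_varsS (IH i' j'); apply: itv_setS.
apply: in_varsD.
  apply: in_varsM; last by apply: sub; lia.
  apply: in_varsD; first exact: in_vars1.
  by apply: in_varsM; apply: xvar_in_vars; move: len; rewrite /itv_len; lia.
rewrite big_nat_cond; apply: in_vars_sum => k /andP[k_itv _].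
by apply: in_varsZ; apply: in_varsM; apply: sub; lia.
Qed.

Lemma mcoeff_ry_rec n i j V :
    (itv_len i j <= n)%N -> (0 < i)%N -> (j <= N)%N -> ~~ odd (itv_len i j) ->
  (ry_rec F N n i j)@_(set_mnm (V :&: itv_set N i j))
    = ry_coef (wvar F N) n i j (mem_index V).
Proof.
have one i' j' : itv_len i' j' = 0%N ->
    (1 : {mpoly (ratW F N)[N]})@_(set_mnm (V :&: itv_set N i' j')) = 1.
  by move=> /itv_set0->; rewrite setI0 set_mnm0 mcoeff1 eqxx.
elim: n i j => [|n IH] i j len_n i_gt0 le_jN even_ij.
  by apply: one; apply/eqP; rewrite -leqn0.
rewrite /=; case: eqP => [/one//|len].
have lt_ij : (i < j)%N by move: len even_ij; rewrite /itv_len; lia.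
rewrite /itv_len in len_n even_ij; rewrite mcoeffD; congr (_ + _).
  have [|o eq_i] := @index_ordP N i; first by lia.
  have [|o' eq_j] := @index_ordP N j; first by lia.
  rewrite {}eq_i {}eq_j /= in lt_ij len_n even_ij le_jN *.
  rewrite itv_set_ends // (mcoeffM_disjoint _ (disjoint_itv_set_ends o o')).
  - by rewrite !xvar_ord mcoeff_1DXX ?IH ?mem_indexE // -?val_eqE /itv_len /=; lia.
  - rewrite !xvar_ord; apply: in_varsD; first exact: in_vars1.
    by apply: in_varsM; apply: in_varsX; rewrite !inE eqxx ?orbT.
  - exact: ry_rec_in_vars.
rewrite [in LHS]big_nat_cond raddf_sum [RHS]big_nat_cond.
apply: eq_bigr => k /andP[k_itv even_ik] /=; rewrite /itv_len in even_ik.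
rewrite mcoeffZ (@itv_setU _ i k j); try lia.
rewrite (mcoeffM_disjoint _ (disjoint_itv_set _ i k j)); try exact: ry_rec_in_vars.
by rewrite !IH // /itv_len; lia.
Qed.

Lemma mcoeff_ry_poly V : ~~ odd N ->
  (ry_poly F N)@_(set_mnm V) = ry_coef (wvar F N) N 1 N (mem_index V).
Proof.
have len : itv_len 1 N = N by rewrite /itv_len subSS subn0.
have := @mcoeff_ry_rec N 1 N V; rewrite /ry_poly /ry_itv len itv_setT setIT.
by move=> coef_V even_N; apply: coef_V.
Qed.

Definition wvar_mpoly (i k j : nat) : {mpoly F[#|Windex N|]} :=
  if (ord_of_index N i, ord_of_index N k, ord_of_index N j)
    is (Some a, Some b, Some c)
  then 'X_(enum_rank ((a, b, c) : Windex N)) else 0.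

Lemma wvar_tofrac i k j : wvar F N i k j = tofrac (wvar_mpoly i k j).
Proof.
rewrite /wvar /wvar_mpoly.
by do 3?[case: ord_of_index => [?|]]; rewrite ?tofrac0.
Qed.

Variable s : nat -> bool.

Definition eval_split_weight (x : 'I_#|Windex N|) : {poly F} :=
  let: (i, k, j) := (enum_val x : Windex N) in split_weight F s i.+1 k.+1 j.+1.

Definition specialize : {rmorphism {mpoly F[#|Windex N|]} -> {poly F}} :=
  mmap (polyC : {rmorphism F -> {poly F}}) eval_split_weight.

Lemma specialize_wvar (i k j : nat) : (0 < i)%N -> (i < k < j)%N -> (j <= N)%N ->
  specialize (wvar_mpoly i k j) = split_weight F s i k j.
Proof.
move=> i_gt0 k_itv le_jN.
have [|oi ->] := @index_ordP N i; first by lia.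
have [|ok ->] := @index_ordP N k; first by lia.
have [|oj ->] := @index_ordP N j; first by lia.
by rewrite /wvar_mpoly /= !valK /= mmapX mmap1U /eval_split_weight enum_rankK.
Qed.

Lemma specialize_ry_coef n a :
  specialize (ry_coef wvar_mpoly n 1 N a) = ry_coef (split_weight F s) n 1 N a.
Proof.
rewrite rmorph_ry_coef; apply: (@eq_ry_coef _ _ _ 1 N) => // i k j.
exact: specialize_wvar.
Qed.

End RyCoefficients.

Section FullRank.
Variables (F : fieldType) (N : nat) (S : {set 'I_N}).
Hypothesis half_S : #|S|.*2 = N.

Lemma exists_leading_pairing : exists E (pi : 'I_N -> 'I_N),
  [/\ involutive pi, pi @^-1: S = ~: S
    & forall V (c := ry_coef (split_weight F (mem_index S)) N 1 N (mem_index V)),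
      (size c <= E.+1)%N /\ c`_E = (pi @^-1: V == V)%:R].
Proof.
have [|E [p [match_p lead_p]]] :=
  exists_leading_matching F _ (balanced_mem_index half_S) (n := N).
  by rewrite /itv_len subSS subn0.
have [pi p_pi [piK swap_S]] := matching_involution match_p.
exists E, pi; split=> // V c; have [size_c coef_c] := lead_p (mem_index V).
by split; rewrite // coef_c (equal_on_pairs_preimset _ p_pi).
Qed.

Definition ry_minor (pi : 'I_N -> 'I_N) : 'M[{mpoly F[#|Windex N|]}]_#|powerset S| :=
  \matrix_(i, j) ry_coef (@wvar_mpoly F N) N 1 N
    (mem_index (enum_subset i :|: pi @^-1: enum_subset j)).

(* Listing the columns in the order of the rows through the pairing, the matrix
   of leading coefficients is the identity. *)
Lemma exists_ry_minor_det_neq0 : exists pi : 'I_N -> 'I_N,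
  pi @^-1: S = ~: S /\ \det (ry_minor pi) != 0.
Proof.
have [E [pi [piK swap_S lead_pi]]] := exists_leading_pairing.
exists pi; split=> //; pose f := specialize F N (mem_index S).
suff : \det (map_mx f (ry_minor pi)) != 0.
  by rewrite det_map_mx; apply: contraNneq => ->; rewrite rmorph0.
suff : (\det (map_mx f (ry_minor pi)))`_(\sum_(i < #|powerset S|) E) != 0.
  by apply: contraNneq => ->; rewrite coef0.
have minorE i j : map_mx f (ry_minor pi) i j = ry_coef
    (split_weight F (mem_index S)) N 1 N
    (mem_index (enum_subset i :|: pi @^-1: enum_subset j)).
  by rewrite !mxE specialize_ry_coef.
rewrite coef_det_top => [|i j]; last first.
  by rewrite minorE; case: (lead_pi (enum_subset i :|: pi @^-1: enum_subset j)).
rewrite (_ : \matrix_(i, j) _ = 1%:M) ?det1 ?oner_eq0 //.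
apply/matrixP => i j; rewrite mxE minorE mxE.
have [_ ->] := lead_pi (enum_subset i :|: pi @^-1: enum_subset j).
rewrite (preimset_swap_eq piK swap_S) ?enum_subset_sub //.
by rewrite (inj_eq (@enum_subset_inj _ _)).
Qed.

Lemma cut_rank_ry_poly : cut_rank S (ry_poly F N) = (2 ^ #|S|)%N.
Proof.
have even_N : ~~ odd N by rewrite -half_S odd_double.
rewrite -card_powerset; apply/eqP; rewrite eqn_leq rank_leq_row /=.
have [pi [swap_S det_neq0]] := exists_ry_minor_det_neq0.
have /fin_all_exists[col colE] : forall j : 'I_#|powerset S|,
    exists i : 'I_#|powerset (~: S)|, enum_subset i = pi @^-1: enum_subset j.
  by move=> j; apply: enum_subset_surj; rewrite -swap_S preimsetS ?enum_subset_sub.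
apply: leq_trans (leq_mxrank_colsub col _); apply/eq_leq/esym.
rewrite (_ : colsub col _ = map_mx (@tofrac _) (ry_minor pi)); last first.
  apply/matrixP => i j; rewrite !mxE colE.
  rewrite mcoeff_ry_poly // rmorph_ry_coef.
  by apply: (@eq_ry_coef _ _ _ 1 N) => // *; exact: wvar_tofrac.
by apply: mxrank_unit; rewrite unitmxE unitfE det_map_mx tofrac_eq0.
Qed.

End FullRank.

Theorem leq_sum_abp_size_ry_poly (F : fieldType) (N m r b : nat)
    (d : 'I_m -> nat) (B : forall i, abp {mpoly (ratW F N)[N]} (d i)) :
    ~~ odd N -> (0 < r)%N -> (32 * b ^ 2 * r <= N)%N -> (m * N.+1 < 2 ^ r)%N ->
    (forall i, r <= d i)%N -> (forall i, exists X, read_once_over X (B i)) ->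
    ry_poly F N = \sum_i abp_eval (B i) ->
  (2 ^ b <= \sum_i abp_size (B i))%N.
Proof.
move=> even_N r_gt0 large_N few le_rd /fin_all_exists[X readX] eq_g.
have exp2_gt0 e : (0 < 2 ^ e)%N by rewrite expn_gt0.
pose bad i := near_even_sets (cut_vars (X i) r) b r.
have [|S card_S good_S] := @exists_half_set_avoiding 'I_N 'I_m bad.
  rewrite card_ord -(ltn_pmul2r (exp2_gt0 r)).
  apply: (@leq_ltn_trans (m * 2 ^ N * N.+1)).
    rewrite mulnAC leq_mul2r big_distrl /= -[m in leqRHS]card_ord -sum_nat_const.
    apply: leq_sum => i _.
    by apply: (card_roabp_near_even_sets (readX i)); rewrite ?r_gt0 ?le_rd.
  by rewrite mulnAC mulnC ltn_pmul2l.
rewrite card_ord in card_S.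
have half_S : #|S|.*2 = N by rewrite card_S even_halfK.
rewrite -(leq_pmul2l (exp2_gt0 #|S|)) -{1}(cut_rank_ry_poly F half_S) eq_g.
apply: leq_trans (leq_mul (cut_rank_sum S _) (leqnn _)) _.
rewrite big_distrl big_distrr /=; apply: leq_sum => i _; rewrite [leqRHS]mulnC.
exact: (roabp_cut_rank (readX i) half_S (good_S i)).
Qed.

(** * Asymptotics *)

Section Asymptotics.
Variable R : realType.
Implicit Types x y c e : R.

Lemma le_powR2 x : 0 <= x -> x <= 2 `^ x.
Proof.
move=> x_ge0; apply/ltW/(lt_le_trans (truncnS_gt x)).
apply: (@le_trans _ _ (2 ^ Num.truncn x)%:R); first by rewrite ler_nat ltn_expl.
by rewrite natrX -powR_mulrn ?ler0n // ler_powR ?ler1n // truncn_le.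
Qed.

Lemma log2_ge1 x : 2 <= x -> 1 <= log2 x.
Proof.
move=> x_ge2; rewrite /log2 ler_pdivlMr ?mul1r ?ln_gt0 ?ltr1n //.
by rewrite ler_ln ?posrE ?ltr0n //; apply: lt_le_trans x_ge2; rewrite ltr0n.
Qed.

Lemma powRD2 x y : 2 `^ (x + y) = 2 `^ x * 2 `^ y.
Proof. by rewrite powRD // pnatr_eq0 implybT. Qed.

Lemma powR2_le_natrX x n : x <= n%:R -> 2 `^ x <= (2 ^ n)%:R.
Proof. by move=> le_xn; rewrite natrX -powR_mulrn ?ler0n // ler_powR ?ler1n. Qed.

Lemma powRVK x e : 0 <= x -> e != 0 -> (x `^ e^-1) `^ e = x.
Proof. by move=> x_ge0 e_neq0; rewrite -powRrM mulVf // powRr1. Qed.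

Lemma exists_natr_ge x : exists N0 : nat, forall N : nat, (N0 <= N)%N -> x <= N%:R.
Proof.
exists (Num.truncn x).+1 => N le_N.
by apply: le_trans (ltW (truncnS_gt x)) _; rewrite ler_nat.
Qed.

Lemma powR_le_scaled_powR c e e' : 0 < c -> e < e' ->
  exists N0 : nat, forall N : nat, (N0 <= N)%N -> N%:R `^ e <= c * N%:R `^ e'.
Proof.
move=> c_gt0 lt_e; pose t := c^-1 `^ (e' - e)^-1.
have [N0 geN0] := exists_natr_ge (t + 1); exists N0 => N /geN0 le_N.
have t_ge0 : 0 <= t by apply: powR_ge0.
have N_gt0 : 0 < N%:R :> R by lra.
rewrite -[e'](subrK e) powRD; last by rewrite (lt0r_neq0 N_gt0) implybT.
rewrite mulrA -[leLHS]mul1r ler_wpM2r ?powR_ge0 // mulrC -ler_pdivrMr // mul1r.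
have <- : t `^ (e' - e) = c^-1.
  by rewrite powRVK ?invr_ge0 ?ltW // gt_eqF ?subr_gt0.
by apply: ge0_ler_powR; rewrite ?nnegrE; lra.
Qed.

Lemma exists_cut_count y : 1000 <= y -> exists r : nat,
  [/\ (0 < r)%N, r%:R <= y ^+ 44
    & 2 `^ (y ^+ 40) * (y ^+ 440 + 1) <= (2 ^ r)%:R].
Proof.
move=> y_ge; have y_ge0 : 0 <= y by lra.
have y_le n : y <= y ^+ n.+1 by apply: ler_eXnr => //; lra.
have := y_le 39%N; have := y_le 43%N; have := y_le 439%N => y440 y44 y40.
have /andP[r_le lt_r] := truncn_itv (le_trans y_ge0 y44).
set r := Num.truncn _ in r_le lt_r; rewrite -natr1 in lt_r.
have large_r : y ^+ 40 + (1 + y * 440) <= r%:R.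
  have : 1000 * y ^+ 40 <= y ^+ 44.
    rewrite (exprD y 4 40) ler_wpM2r ?exprn_ge0 //.
    exact: le_trans y_ge (y_le 3%N).
  by lra.
exists r; split=> //; first by rewrite -(ltr_nat R); lra.
apply: le_trans (powR2_le_natrX large_r).
rewrite powRD2 ler_wpM2l ?powR_ge0 // powRD2 powRr1 ?ler0n //.
apply: (@le_trans _ _ (2 * y ^+ 440)); first by lra.
rewrite ler_wpM2l ?ler0n // powRrM powR_mulrn ?powR_ge0 //.
by rewrite lerXn2r ?nnegrE ?powR_ge0 ?le_powR2.
Qed.

Lemma exists_imbalance_bound y : 1000 <= y -> exists b : nat,
  2 `^ (y ^+ 40) * 2 `^ (y ^+ 99) <= (2 ^ b)%:R :> R
  /\ 32 * b%:R ^+ 2 * y ^+ 44 <= y ^+ 440.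
Proof.
move=> y_ge; have y_ge0 : 0 <= y by lra.
have y_le n : y <= y ^+ n.+1 by apply: ler_eXnr => //; lra.
have y40_le : y ^+ 40 <= y ^+ 99 by rewrite ler_weXn2l //; lra.
have y99_ge := y_le 98%N.
have b_ge0 : 0 <= 2 * y ^+ 99 by lra.
have /andP[le_b b_lt] := truncn_itv b_ge0.
set k := Num.truncn _ in le_b b_lt; rewrite -natr1 in b_lt.
exists k.+1; split; first by rewrite -powRD2; apply: powR2_le_natrX; lra.
have -> : y ^+ 440 = y ^+ 198 * (y ^+ 99) ^+ 2 * y ^+ 44.
  by rewrite -exprM -!exprD.
rewrite ler_wpM2r ?exprn_ge0 //.
apply: (@le_trans _ _ (32 * (3 * y ^+ 99) ^+ 2)).
  by rewrite ler_wpM2l ?ler0n // lerXn2r ?nnegrE ?ler0n //; lra.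
by rewrite exprMn mulrA ler_wpM2r ?sqr_ge0 //; have := y_le 197%N; lra.
Qed.

(* 440 is the least common multiple of the denominators 10, 11 and 40, so that
   all the exponents become integral for the 440-th root [y] of [N]. *)
Lemma exists_cut_parameters (alpha c : R) : 1 / 10 < alpha -> 0 < c ->
  exists N0 : nat, forall N : nat, (N0 <= N)%N -> exists r b : nat,
    [/\ (0 < r)%N, r%:R <= c * N%:R `^ alpha, (32 * b ^ 2 * r <= N)%N,
        2 `^ (N%:R `^ (1 / 11)) * N.+1%:R <= (2 ^ r)%:R :> R
      & 2 `^ (N%:R `^ (1 / 11)) * 2 `^ (N%:R `^ (9 / 40) / log2 N%:R)
          <= (2 ^ b)%:R :> R].
Proof.
move=> lt_alpha c_gt0; have [N1 geN1] := powR_le_scaled_powR c_gt0 lt_alpha.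
have [N2 geN2] := exists_natr_ge (1000 ^+ 440 : R).
exists (maxn N1 N2) => N; rewrite geq_max => /andP[/geN1 le_alpha /geN2 {geN2}le_N].
pose y : R := N%:R `^ (440%:R)^-1.
have y_ge0 : 0 <= y by apply: powR_ge0.
have Ny : N%:R = y ^+ 440 by rewrite -powR_mulrn // powRVK ?ler0n ?pnatr_eq0.
have {le_N} y_ge : 1000 <= y by rewrite -(@ler_pXn2r _ 440) ?nnegrE ?ler0n -?Ny.
have root n (e : R) : n%:R = 440%:R * e -> N%:R `^ e = y ^+ n.
  by move=> n_e; rewrite -powR_mulrn // -powRrM n_e mulKf // pnatr_eq0.
have root11 : N%:R `^ (1 / 11) = y ^+ 40 by apply: root; lra.
have root10 : N%:R `^ (1 / 10) = y ^+ 44 by apply: root; lra.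
have root40 : N%:R `^ (9 / 40) = y ^+ 99 by apply: root; lra.
have [r [r_gt0 r_le few]] := exists_cut_count y_ge.
have [b [large_b b_le]] := exists_imbalance_bound y_ge.
exists r, b; rewrite root11 root40; split=> //.
- by apply: le_trans r_le _; rewrite -root10.
- rewrite -(ler_nat R) Ny natrM natrM natrX; apply: le_trans b_le.
  by rewrite ler_wpM2l ?mulr_ge0 ?ler0n ?sqr_ge0.
- by rewrite -(natr1 N) Ny.
apply: le_trans large_b; rewrite ler_wpM2l ?powR_ge0 // ler_powR ?ler1n //.
have N_ge2 : 2 <= N%:R :> R.
  by rewrite Ny; apply: (@le_trans _ _ y); [|apply: ler_eXnr => //]; lra.
have log_ge1 := log2_ge1 N_ge2.
rewrite ler_pdivrMr; last exact: lt_le_trans ltr01 log_ge1.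
by rewrite ler_peMr // exprn_ge0.
Qed.

End Asymptotics.

Theorem theorem4 (R : realType) (F : fieldType) (alpha : R)
    (halpha : 1 / 10 < alpha)
    (c1 c2 : R) (hc1 : 0 < c1) (hc2 : 0 < c2) (C : nat) :
  exists N0 : nat, forall N : nat, (N0 <= N)%N -> ~~ odd N ->
  forall (m : nat) (f : 'I_m -> {mpoly (ratW F N)[N]}),
    (forall i : 'I_m, exists (d : nat) (P : abp {mpoly (ratW F N)[N]} d),
       [/\ alpha_sparse_roabp alpha c1 c2 C P,
           abp_eval P = f i
         & (abp_size P)%:R < 2 `^ (N%:R `^ (9 / 40) / log2 N%:R) :> R]) ->
    ry_poly F N = \sum_(i < m) f i ->
    2 `^ (N%:R `^ (1 / 11)) <= m%:R :> R.
Proof.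
have [N0 params] := exists_cut_parameters halpha hc1; exists N0 => N /params.
case=> r [b [r_gt0 r_le large_N few small]] even_N m f.
move=> /fin_all_exists[d /fin_all_exists[P P_f]] eq_g.
rewrite leNgt; apply/negP => lt_m.
have : (2 ^ b <= \sum_i abp_size (P i))%N.
  apply: leq_sum_abp_size_ry_poly r_gt0 large_N _ _ _ _ => //.
  - rewrite -(ltr_nat R) natrM; apply: lt_le_trans few.
    by rewrite ltr_pM2r ?ltr0n.
  - move=> i; have [[le_d _ _] _ _] := P_f i.
    by rewrite -(ler_nat R); apply: le_trans le_d.
  - by move=> i; have [[_ _ [t _ /sparse_roabp_read_once]]] := P_f i.
  - by rewrite eq_g; apply: eq_bigr => i _; case: (P_f i).
rewrite leqNgt => /negP; apply; rewrite -(ltr_nat R) natr_sum.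
apply: le_lt_trans _ (lt_le_trans _ small).
  by apply: ler_sum => i _; case: (P_f i) => _ _ /ltW; apply.
by rewrite sumr_const card_ord -[ltLHS]mulr_natl ltr_pM2r ?powR_gt0.
Qed.
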